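(* Let $\nu\in(0,1]$ and $p=1+\nu$. Let $f:\mathbb{R}^n\to\mathbb{R}$ be Fréchet differentiable with $\nu$-Hölder continuous gradient on $\mathbb{R}^n$ with constant $L_\nu$, and let $g:\mathbb{R}^n\to\mathbb{R}\cup\{+\infty\}$ be proper, lower semicontinuous, and high-order prox-bounded of order $p$ with threshold $\gamma^{g,p}>0$. Set $\varphi:=f+g$. Then there exists $\overline{\gamma}\in(0,\gamma^{g,p})$ such that for each $\gamma\in(0,\overline{\gamma})$ and any $r>0$, there exists a finite $\tau>0$ satisfying $$\mathbf{T}_{\gamma\varphi}^{p}(x)=\operatorname*{arg\,min}_{\{y\in\mathbb{R}^n\,\mid\,\|y\|\le\tau\}}\left\{\ell(x,y)+\frac{1}{p\gamma}\|x-y\|^p\right\},\qquad \forall x\in\mathbf{B}(0;r).$$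
   Context: $\|\cdot\|$ and $\langle\cdot,\cdot\rangle$ are the Euclidean norm and inner product on $\mathbb{R}^n$; $\mathbf{B}(\overline{x};r)$ is the open ball with center $\overline{x}$ and radius $r$. A function $h:\mathbb{R}^n\to\mathbb{R}\cup\{+\infty\}$ is proper if it is finite at some point. $f$ has a $\nu$-Hölder continuous gradient with constant $L_\nu\ge 0$ if $\|\nabla f(y)-\nabla f(x)\|\le L_\nu\|y-x\|^\nu$ for all $x,y\in\mathbb{R}^n$. A proper function $g$ is high-order prox-bounded of order $p>1$ if there exist $\gamma>0$ and $x\in\mathbb{R}^n$ with $\inf_{y\in\mathbb{R}^n}\{g(y)+\frac{1}{p\gamma}\|x-y\|^p\}>-\infty$; the supremum of all such $\gamma$ is the threshold $\gamma^{g,p}\in(0,+\infty]$. For $\gamma>0$, set $\ell(x,y):=f(x)+\langle\nabla f(x),y-x\rangle+g(y)$. The high-order forward-backward splitting mapping (HiFBS) of $\varphi=f+g$ is the set-valued map $$\mathbf{T}_{\gamma\varphi}^{p}(x):=\operatorname*{arg\,min}_{y\in\mathbb{R}^n}\left\{\ell(x,y)+\frac{1}{p\gamma}\|x-y\|^p\right\}.$$ *)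

(* Defs.v *)
From HB Require Import structures.
From mathcomp Require Export all_boot all_order all_algebra.
From mathcomp Require Export all_classical all_reals all_analysis.

Set Implicit Arguments.
Unset Strict Implicit.
Unset Printing Implicit Defensive.

Import Order.TTheory GRing.Theory Num.Theory.
Import numFieldNormedType.Exports.

Local Open Scope classical_set_scope.
Local Open Scope ring_scope.

Section Euclidean.
Context {R : realType} {n : nat}.
Implicit Types (u v x c : 'rV[R]_n) (f : 'rV[R]_n -> R).

Definition inner u v : R := \sum_(i < n) u 0 i * v 0 i.

(* The library norm `|u| on row vectors is the sup norm, hence a separate
   Euclidean norm; both induce the same topology, so that the library notions
   of differentiability and lower semicontinuity are the usual ones. *)
Definition enorm u : R := Num.sqrt (inner u u).

Definition eball c (r : R) : set 'rV[R]_n := [set x | enorm (x - c) < r].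

(* The Riesz representative of the Fréchet derivative, given by its
   coordinates: 'd f x v = inner (grad f x) v when f is differentiable at x. *)
Definition grad f x : 'rV[R]_n := \row_(i < n) 'd f x (delta_mx 0 i).

Definition holder_gradient (nu L : R) f :=
  forall x y, enorm (grad f y - grad f x) <= L * enorm (y - x) `^ nu.

End Euclidean.

Section ExtendedValued.
Context {R : realType} {n : nat}.
Implicit Types (f : 'rV[R]_n -> R) (g : 'rV[R]_n -> \bar R).
Local Open Scope ereal_scope.

(* Functions into R U {+oo} are functions into \bar R avoiding -oo. *)
Definition avoids_ninfty g := forall x, g x != -oo.

Definition proper_fun g := exists x, g x \is a fin_num.

Definition argmin (D : set 'rV[R]_n) g : set 'rV[R]_n :=
  [set y | D y /\ forall z, D z -> g y <= g z].

Definition prox_term (p gamma : R) (x y : 'rV[R]_n) : R :=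
  ((p * gamma)^-1 * enorm (x - y) `^ p)%R.

Definition prox_bounded_params (p : R) g : set R :=
  [set gamma | (0 < gamma)%R /\
     exists x, -oo < ereal_inf [set g y + (prox_term p gamma x y)%:E | y in setT]].

Definition ho_prox_bounded (p : R) g :=
  exists gamma, prox_bounded_params p g gamma.

Definition ho_prox_threshold (p : R) g : \bar R :=
  ereal_sup [set gamma%:E | gamma in prox_bounded_params p g].

Definition fb_model f g (x y : 'rV[R]_n) : \bar R :=
  (f x + inner (grad f x) (y - x))%R%:E + g y.

Definition fb_objective f g (p gamma : R) (x y : 'rV[R]_n) : \bar R :=
  fb_model f g x y + (prox_term p gamma x y)%:E.

Definition HiFBS f g (p gamma : R) (x : 'rV[R]_n) : set 'rV[R]_n :=
  argmin setT (fb_objective f g p gamma x).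

End ExtendedValued.

(* Main.v *)
(* Fix y0 with g y0 finite. If beyond some radius tau >= |y0| the objective at
   y exceeds its value at y0 for every x in the ball, then the global and the
   restricted minimisers coincide, whether or not they exist. In that comparison
   the term f x cancels and the gradient is bounded on the ball by the Hölder
   condition. Prox-boundedness with parameter gamma0 gives
   g y >= c - |x0 - y|^p / (p gamma0), and p <= 2 makes gamma < gamma0 / 8 small
   enough for |x - y|^p / (p gamma) to absorb this lower bound as well as the
   linear term, which is of lower order because p > 1. *)
Require Import Defs.
From mathcomp Require Import ring lra.
Import Order.TTheory GRing.Theory Num.Theory.
Import numFieldNormedType.Exports.
Local Open Scope classical_set_scope.
Local Open Scope ring_scope.

Section EuclideanNorm.
Context {R : realType} {n : nat}.
Implicit Types u v w : 'rV[R]_n.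

Lemma innerC u v : inner u v = inner v u.
Proof. by apply: eq_bigr => i _; rewrite mulrC. Qed.

Lemma innerDl u v w : inner (u + v) w = inner u w + inner v w.
Proof. by rewrite -big_split; apply: eq_bigr => i _; rewrite mxE mulrDl. Qed.

Lemma innerZl (a : R) u v : inner (a *: u) v = a * inner u v.
Proof. by rewrite mulr_sumr; apply: eq_bigr => i _; rewrite mxE mulrA. Qed.

Lemma innerNl u v : inner (- u) v = - inner u v.
Proof. by rewrite -scaleN1r innerZl mulN1r. Qed.

Lemma innerDr u v w : inner u (v + w) = inner u v + inner u w.
Proof. by rewrite innerC innerDl !(innerC u). Qed.

Lemma innerZr (a : R) u v : inner u (a *: v) = a * inner u v.
Proof. by rewrite innerC innerZl innerC. Qed.

Lemma inner_ge0 u : 0 <= inner u u.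
Proof. by apply: sumr_ge0 => i _; rewrite -expr2 sqr_ge0. Qed.

Lemma enorm_ge0 u : 0 <= enorm u.
Proof. exact: sqrtr_ge0. Qed.

Lemma sqr_enorm u : enorm u ^+ 2 = inner u u.
Proof. by rewrite sqr_sqrtr ?inner_ge0. Qed.

Lemma enorm0_eq0 u : enorm u = 0 -> u = 0.
Proof.
move=> u0; have : inner u u = 0 by rewrite -sqr_enorm u0 expr0n.
move=> /eqP; rewrite psumr_eq0 => [/allP uu|i _]; last by rewrite -expr2 sqr_ge0.
apply/rowP => i; rewrite mxE; apply/eqP.
by have := uu i (mem_index_enum i); rewrite mulf_eq0 orbb.
Qed.

Lemma inner0l u : inner 0 u = 0.
Proof. by rewrite -(scale0r u) innerZl mul0r. Qed.

Lemma enormN u : enorm (- u) = enorm u.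
Proof. by rewrite /enorm innerNl innerC innerNl opprK. Qed.

Lemma enormB u v : enorm (u - v) = enorm (v - u).
Proof. by rewrite -enormN opprB. Qed.

Lemma Cauchy_Schwarz u v : inner u v <= enorm u * enorm v.
Proof.
have [u0|u0] := eqVneq (enorm u) 0.
  by rewrite (enorm0_eq0 _ u0) inner0l mulr_ge0 ?enorm_ge0.
have [v0|v0] := eqVneq (enorm v) 0.
  by rewrite (enorm0_eq0 _ v0) innerC inner0l mulr_ge0 ?enorm_ge0.
have uv_gt0 : 0 < enorm u * enorm v.
  by rewrite mulr_gt0 // lt0r ?u0 ?v0 enorm_ge0.
(* Expanded, this square is 2|u||v|(|u||v| - <u,v>), and the factor |u||v| is positive. *)
have := inner_ge0 (enorm v *: u + (- enorm u) *: v).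
rewrite !(innerDl, innerDr, innerZl, innerZr) (innerC v u) -!sqr_enorm => h.
by rewrite -(ler_pM2l uv_gt0); nra.
Qed.

Lemma ler_enormD u v : enorm (u + v) <= enorm u + enorm v.
Proof.
rewrite -(@ler_pXn2r _ 2) ?nnegrE ?addr_ge0 ?enorm_ge0 //.
rewrite sqr_enorm innerDl !innerDr (innerC v u) -!sqr_enorm.
by have := Cauchy_Schwarz u v; nra.
Qed.

Lemma ler_enormB u v : enorm (u - v) <= enorm u + enorm v.
Proof. by rewrite -(enormN v) ler_enormD. Qed.

Lemma lerB_enorm u v : enorm v - enorm u <= enorm (u - v).
Proof.
by rewrite lerBlDr enormB; apply: le_trans (ler_enormD _ _); rewrite subrK.
Qed.

Lemma inner_ge u v : - (enorm u * enorm v) <= inner u v.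
Proof. by rewrite lerNl -innerNl -(enormN u) Cauchy_Schwarz. Qed.

End EuclideanNorm.

(** With u = t - r large, t + s <= 2u and p <= 2 give a(t + s)^p <= 4a u^p <= (b/2) u^p. The other
    half of b u^p equals (b/2) u^nu u, which outgrows every linear term. *)
Lemma powR_coercive {R : realType} {nu p a b M : R} (C : R) {s r : R} :
  0 < nu -> nu <= 1 -> p = 1 + nu -> 0 <= a -> 0 < b -> 8 * a <= b ->
  0 <= M -> 0 <= s -> 0 <= r ->
  exists2 T, r <= T & forall t, T <= t ->
    C < b * (t - r) `^ p - a * (t + s) `^ p - M * t.
Proof.
move=> nu0 nu1 pE a0 b0 ab M0 s0 r0.
(* Since M t = M u + M r, the constant to beat is C + M r; K exceeds it strictly. *)
pose K := `|C + M * r| + 1.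
have K0 : 0 < K by rewrite ltr_wpDl.
have CK : C + M * r < K by rewrite /K; have := ler_norm (C + M * r); lra.
(* (b/2) A = M + K. The summands of U ensure in turn u >= 1, u >= s + r (so t + s <= 2u) and u^nu >=
   A. *)
pose A := 2 * (M + K) / b.
have A0 : 0 <= A by rewrite divr_ge0 ?(ltW b0) // mulr_ge0 ?addr_ge0 ?(ltW K0).
pose U := 1 + s + r + A `^ nu^-1.
have AU0 : 0 <= A `^ nu^-1 by exact: powR_ge0.
exists (r + U); first by rewrite /U; lra.
move=> t tU; pose u := t - r.
have u1 : 1 <= u by rewrite /u; rewrite /U in tU; lra.
have u0 : 0 < u by lra.
have uA : A <= u `^ nu.
  have -> : A = (A `^ nu^-1) `^ nu by rewrite -powRrM mulVf ?gt_eqF // powRr1.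
  apply: ge0_ler_powR; rewrite ?nnegrE ?(ltW nu0) ?(ltW u0) //.
  by rewrite /u; rewrite /U in tU; lra.
have upE : u `^ p = u * u `^ nu.
  by rewrite pE powRD ?powRr1 ?(ltW u0) // (gt_eqF u0) implybT.
have ts : (t + s) `^ p <= 4 * u `^ p.
  have p0 : 0 <= p by lra.
  apply: (@le_trans _ _ ((2 * u) `^ p)).
    by apply: ge0_ler_powR; rewrite ?nnegrE //; rewrite /U in tU; rewrite /u; lra.
  rewrite powRM ?(ltW u0) //; apply: ler_wpM2r; first exact: powR_ge0.
  (* Here p = 1 + nu <= 2 bounds 2^p by 4. *)
  apply: (@le_trans _ _ (2 `^ 2)); first by apply: ler_powR; lra.
  by rewrite powR_mulrn //; lra.
have ats : a * (t + s) `^ p <= b / 2 * u `^ p.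
  apply: (le_trans (ler_wpM2l a0 ts)); rewrite mulrA; apply: ler_wpM2r.
    exact: powR_ge0.
  lra.
have bA : M + K <= b / 2 * u `^ nu.
  have -> : M + K = b / 2 * A by rewrite /A; field; rewrite gt_eqF.
  by apply: ler_wpM2l uA; lra.
have Kup : (M + K) * u <= b / 2 * u `^ p.
  by rewrite upE mulrCA [_ * u]mulrC; apply: ler_wpM2l => //; exact: ltW.
have Ku : K <= K * u by rewrite ler_peMr // ltW.
rewrite -/u; have -> : M * t = M * u + M * r by rewrite /u; ring.
rewrite mulrDl in Kup; lra.
Qed.

Section Argmin.
Context {R : realType} {n : nat}.
Local Open Scope ereal_scope.

(** A global minimiser cannot lie outside [D], where [y0] does strictly better; a minimiser over [D]
    is at least as good as [y0], hence better than every point outside. *)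
Lemma argmin_restrict (D : set 'rV[R]_n) (h : 'rV[R]_n -> \bar R)
    (y0 : 'rV[R]_n) :
  D y0 -> (forall y, ~ D y -> h y0 < h y) -> argmin setT h = argmin D h.
Proof.
move=> Dy0 hD; apply/seteqP; split=> y [Dy ymin].
- split=> [|z _]; last exact: ymin.
  by apply: contrapT => /hD; rewrite ltNge => /negP; apply; exact: ymin.
- split=> // z _; have [Dz|Dz] := pselect (D z); first exact: ymin.
  exact: le_trans (ymin _ Dy0) (ltW (hD _ Dz)).
Qed.

Lemma prox_bounded_minorant {p gamma : R} {g : 'rV[R]_n -> \bar R} :
  prox_bounded_params p g gamma ->
  exists x0 (c : R), forall y, (c - prox_term p gamma x0 y)%:E <= g y.
Proof.
move=> [_ [x0 inf_gt]]; exists x0.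
set S := [set _ | _ in _] in inf_gt.
have [c cS] : exists c : R, c%:E <= ereal_inf S.
  (* If the infimum is +oo, any real is a lower bound; 0 is chosen. *)
  by move: inf_gt; case: (ereal_inf S) => [c||] // _; [exists c | exists 0%R; rewrite leey].
exists c => y; rewrite EFinB leeBlDr //.
by apply: (le_trans cS); apply: ereal_inf_lbound; exists y.
Qed.

End Argmin.

Lemma holder_gradient_bounded {R : realType} {n : nat} {nu L r : R}
    {f : 'rV[R]_n -> R} : 0 <= nu -> 0 <= L -> holder_gradient nu L f ->
  forall x, eball 0 r x -> enorm (grad f x) <= enorm (grad f 0) + L * r `^ nu.
Proof.
move=> nu0 L0 hf x; rewrite /eball /= => xr.
rewrite -[grad f x](subrK (grad f 0)) addrC; apply: (le_trans (ler_enormD _ _)).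
rewrite lerD2l; apply: (le_trans (hf 0 x)); apply: ler_wpM2l => //.
by apply: ge0_ler_powR; rewrite ?nnegrE ?enorm_ge0 ?(le_trans (enorm_ge0 _) (ltW xr)) // ltW.
Qed.

Theorem proposition18 (R : realType) (n : nat) (nu p L : R)
    (f : 'rV[R]_n -> R) (g : 'rV[R]_n -> \bar R)
    (nu_gt0 : 0 < nu) (nu_le1 : nu <= 1) (pE : p = 1 + nu)
    (L_ge0 : 0 <= L)
    (f_diff : forall x : 'rV[R]_n, differentiable f x)
    (f_holder : holder_gradient nu L f)
    (g_noo : avoids_ninfty g)
    (g_proper : proper_fun g)
    (g_lsc : lower_semicontinuous g)
    (g_pb : ho_prox_bounded p g)
    (thr_gt0 : (0 < ho_prox_threshold p g)%E) :
  exists gammabar : R,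
    [/\ 0 < gammabar, (gammabar%:E < ho_prox_threshold p g)%E &
      forall gamma : R, 0 < gamma -> gamma < gammabar ->
      forall r : R, 0 < r ->
      exists tau : R, 0 < tau /\
        forall x : 'rV[R]_n, eball 0 r x ->
          HiFBS f g p gamma x =
          argmin [set y | enorm y <= tau] (fb_objective f g p gamma x)].
Proof.
have [gamma0 g0P] := g_pb; have gamma0_gt0 : 0 < gamma0 by case: g0P.
have [x0 [c cP]] := prox_bounded_minorant g0P.
have [y0 y0fin] := g_proper.
have p_gt0 : 0 < p by lra.
(* Dividing by 8 yields [8 * a <= b] below and also puts the bound strictly under the threshold,
   which is at least [gamma0]. *)
exists (gamma0 / 8); split; first lra.
  apply: (@lt_le_trans _ _ gamma0%:E); first by rewrite lte_fin; lra.
  by apply: ereal_sup_ubound; exists gamma0.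
move=> gamma gamma_gt0 gamma_lt r r_gt0.
pose a := (p * gamma0)^-1; pose b := (p * gamma)^-1.
pose M := enorm (grad f 0) + L * r `^ nu.
(* [C] gathers what does not depend on y in the comparison of the objective at y with its value at
   [y0]. *)
pose C := M * enorm y0 - c + fine (g y0) + b * (r + enorm y0) `^ p.
have a_gt0 : 0 < a by rewrite invr_gt0 mulr_gt0.
have b_gt0 : 0 < b by rewrite invr_gt0 mulr_gt0.
have ab : 8 * a <= b.
  have -> : 8 * a = (p * (gamma0 / 8))^-1 by rewrite /a; field; rewrite !gt_eqF.
  by rewrite lef_pV2 ?posrE ?mulr_gt0 // ler_pM2l // ltW.
have M_ge0 : 0 <= M by rewrite addr_ge0 ?enorm_ge0 ?mulr_ge0 ?powR_ge0.
have [T rT TP] := powR_coercive C nu_gt0 nu_le1 pE (ltW a_gt0) b_gt0 ab M_ge0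
  (enorm_ge0 x0) (ltW r_gt0).
have y0_ge0 := enorm_ge0 y0; have T_gt0 := lt_le_trans r_gt0 rT.
(* This radius keeps [y0] inside the ball and forces |y| > T outside it. *)
exists (T + enorm y0); split; first by rewrite ltr_wpDr.
move=> x xr; have gradM := holder_gradient_bounded (ltW nu_gt0) L_ge0 f_holder _ xr.
have {}xr : enorm x < r by move: xr; rewrite /eball /= subr0.
apply: (argmin_restrict _ _ y0) => /= [|y /negP].
  by rewrite lerDr ltW.
rewrite -ltNge => ytau.
rewrite /fb_objective /fb_model -(fineK y0fin).
(* If g y = +oo, the finite value at [y0] is smaller at once. *)
have := cP y; have := g_noo y; case: (g y) => [gy _||//]; last first.
  by move=> _ _; rewrite addey // addye // -!EFinD ltry.
rewrite -!EFinD lee_fin lte_fin /prox_term -/a -/b => cgy.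
have Ty : T <= enorm y by apply: le_trans (ltW ytau); rewrite lerDl.
have := TP _ Ty; rewrite /C => big.
have x0y : a * enorm (x0 - y) `^ p <= a * (enorm y + enorm x0) `^ p.
  apply: ler_wpM2l; first exact: ltW.
  apply: ge0_ler_powR; rewrite ?nnegrE ?addr_ge0 ?enorm_ge0 ?(ltW p_gt0) //.
  by rewrite [leRHS]addrC ler_enormB.
(* |x - y| >= |y| - |x| >= |y| - r; [r <= T] makes the last base nonnegative, so the power is
   monotone. *)
have xy : b * (enorm y - r) `^ p <= b * enorm (x - y) `^ p.
  apply: ler_wpM2l; first exact: ltW.
  apply: ge0_ler_powR; rewrite ?nnegrE ?enorm_ge0 ?(ltW p_gt0) //.
    by rewrite subr_ge0 (le_trans rT Ty).
  by apply: le_trans (lerB_enorm x y); rewrite lerD2l lerN2 ltW.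
have xy0 : b * enorm (x - y0) `^ p <= b * (r + enorm y0) `^ p.
  apply: ler_wpM2l; first exact: ltW.
  apply: ge0_ler_powR; rewrite ?nnegrE ?addr_ge0 ?enorm_ge0 ?(ltW p_gt0) ?(ltW r_gt0) //.
  by apply: (le_trans (ler_enormB x y0)); rewrite lerD2r ltW.
(* The contributions of -x cancel, so only [y0] and y are paired with the gradient. *)
have lin : inner (grad f x) (y0 - x) - inner (grad f x) (y - x)
    <= M * enorm y0 + M * enorm y.
  rewrite !innerDr opprD addrACA subrr addr0 lerD //.
    by apply: (le_trans (Cauchy_Schwarz _ _)); rewrite ler_wpM2r ?enorm_ge0.
  by rewrite lerNl; apply: le_trans (inner_ge _ _); rewrite lerN2 ler_wpM2r ?enorm_ge0.
(* [lra] compares atoms up to conversion, which is costly on [enorm] and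
   [powR]; hence the generalisation. *)
move: lin x0y xy xy0 big cgy.
move: (f x) (inner _ (y0 - x)) (inner _ (y - x)) (fine (g y0)).
move: (M * enorm y) (M * enorm y0) (b * enorm (x - y) `^ p).
move: (b * enorm (x - y0) `^ p) (b * (enorm y - r) `^ p).
move: (b * (r + enorm y0) `^ p) (a * enorm (x0 - y) `^ p).
move: (a * (enorm y + enorm x0) `^ p); clear; move=> *; lra.
Qed.
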